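(* Let $Y\in\mathbb{R}^{n\times p}$, $\mathcal M=\{u\in\mathbb{R}^n:\|u\|=1\}$, $\widehat F(x)=\|Y^Tx\|_1+\delta_{\mathcal M}(x)$, and let $\mathcal X\subseteq\mathcal M$ be a set of weak sharp minima for the problem $\min\{\|Y^Tx\|_1:x\in\mathcal M\}$ (i.e., for $\widehat F$) with parameter $(\alpha,\delta)$, for some $\alpha>0$ and $\delta>0$. Let $\{x^k\}$ be the sequence generated by $\mathsf{ManPPA}_{\mathsf{rw}}$ with $\phi(s)=s$, and suppose that $\lim_{k\to\infty}x^k=:x^*\in\mathcal X$. Then $\{x^k\}$ converges finitely, i.e., there exists $k_0$ such that $x^k=x^*$ for all $k\ge k_0$.
   Context: $\|\cdot\|$ is the Euclidean norm, $\|\cdot\|_1$ the $\ell_1$ norm, $\|\cdot\|_2$ the operator norm of a matrix, $\delta_{\mathcal M}$ the indicator function of $\mathcal M$ ($0$ on $\mathcal M$, $+\infty$ elsewhere), $\mathrm{dist}(x,C)=\inf_{y\in C}\|x-y\|$. Algorithm ($\mathsf{ManPPA}_{\mathsf{rw}}$ with $\phi(s)=s$). Let $L_f=\sqrt p\,\|Y\|_2$. Choose $x^0\in\mathcal M$ and $t\in(0,2/L_f)$. For $k=0,1,2,\dots$: let $d^k$ be the (unique) minimizer of $d\mapsto\|Y^T(x^k+d)\|_1+\frac1{2t}\|d\|^2$ over $\{d\in\mathbb{R}^n:\langle x^k,d\rangle=0\}$; set $x^{k+1}=\frac{x^k+d^k}{\|x^k+d^k\|}$. Weak sharp minima. A set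 $\mathcal X\subseteq\mathrm{dom}\,h$ is a set of weak sharp minima for a proper function $h:\mathbb{R}^n\to(-\infty,\infty]$ with parameter $(\alpha,\delta)$, $\alpha>0,\delta>0$, if $h(x)\ge h(\bar x)+\alpha\,\mathrm{dist}(x,\mathcal X)$ for all $\bar x\in\mathcal X$ and all $x$ with $\mathrm{dist}(x,\mathcal X)\le\delta$. *)

(* Defs.v *)
From HB Require Import structures.
From mathcomp Require Import all_boot all_order all_algebra.
From mathcomp Require Import all_classical all_reals all_analysis.

Set Implicit Arguments.
Unset Strict Implicit.
Unset Printing Implicit Defensive.

Import Order.TTheory GRing.Theory Num.Theory.
Import numFieldNormedType.Exports.

Local Open Scope classical_set_scope.
Local Open Scope ring_scope.

Section Norms.
Variables (R : realType) (n : nat).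
Implicit Types (u v x : 'cV[R]_n) (C : set 'cV[R]_n).

Definition dotp u v : R := \sum_i u i 0 * v i 0.

(* The norm that mathcomp-analysis puts on matrices is the max norm, hence
   this separate definition; both induce the same topology. *)
Definition enorm u : R := Num.sqrt (dotp u u).

Definition l1norm u : R := \sum_i `|u i 0|.

Definition usphere : set 'cV[R]_n := [set u | enorm u = 1].

(* Extended-real valued, so that the distance to the empty set is +oo. *)
Definition dist x C : \bar R := ereal_inf [set (enorm (x - y))%:E | y in C].

Definition delta_ind C x : \bar R := if x \in C then 0%E else +oo%E.

Definition dom (h : 'cV[R]_n -> \bar R) : set 'cV[R]_n :=
  [set x | (h x < +oo)%E].

Definition proper_fun (h : 'cV[R]_n -> \bar R) : Prop :=
  (forall x, h x != -oo%E) /\ dom h !=set0.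

Definition weak_sharp_minima (h : 'cV[R]_n -> \bar R) (X : set 'cV[R]_n)
    (alpha delta : R) : Prop :=
  [/\ proper_fun h, X `<=` dom h, 0 < alpha, 0 < delta &
      forall xbar x, X xbar -> (dist x X <= delta%:E)%E ->
        (h xbar + alpha%:E * dist x X <= h x)%E].

Definition is_minimizer (g : 'cV[R]_n -> R) C x : Prop :=
  C x /\ forall y, C y -> g x <= g y.

End Norms.

Arguments usphere {R n}.

Section ManPPA.
Variables (R : realType) (n p : nat).

(* The set is nonempty and bounded, so the real-valued sup is the genuine
   supremum. *)
Definition opnorm (Y : 'M[R]_(n, p)) : R :=
  sup [set enorm (Y *m v) | v in [set v : 'cV[R]_p | enorm v <= 1]].

Definition Lf (Y : 'M[R]_(n, p)) : R := Num.sqrt p%:R * opnorm Y.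

Definition Fhat (Y : 'M[R]_(n, p)) (x : 'cV[R]_n) : \bar R :=
  ((l1norm (Y^T *m x))%:E + delta_ind usphere x)%E.

Definition subpb_obj (Y : 'M[R]_(n, p)) (t : R) (x d : 'cV[R]_n) : R :=
  l1norm (Y^T *m (x + d)) + (2 * t)^-1 * enorm d ^+ 2.

(* When Lf Y = 0 the bound 2 / Lf Y is read as +oo (in MathComp 2 / 0 = 0,
   which would leave no admissible t). *)
Definition ManPPA_rw (Y : 'M[R]_(n, p)) (t : R) (x d : nat -> 'cV[R]_n) :
    Prop :=
  [/\ usphere (x 0%N),
      0 < t,
      (0 < Lf Y -> t < 2 / Lf Y),
      (forall k, is_minimizer (subpb_obj Y t (x k))
                   [set e | dotp (x k) e = 0] (d k)) &
      (forall k, x k.+1 = (enorm (x k + d k))^-1 *: (x k + d k))].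

End ManPPA.

(* Main.v *)
Require Import Defs.
From HB Require Import structures.
From mathcomp Require Import all_boot all_order all_algebra.
From mathcomp Require Import all_classical all_reals all_analysis.
From mathcomp Require Import ring lra.

Set Implicit Arguments.
Unset Strict Implicit.
Unset Printing Implicit Defensive.

Import Order.TTheory GRing.Theory Num.Theory.
Import numFieldNormedType.Exports.

Local Open Scope classical_set_scope.
Local Open Scope ring_scope.

(** The proof is local and uses only that f(x) = ||Y^T x||_1 is convex,
    nonnegative and positively homogeneous.  Let z = x + d be the point
    reached by the subproblem from x, and u = z / ||z|| the next iterate.

    Near the limit xstar, f(u) - f(xstar) is squeezed from two sides.  From
    below, weak sharpness gives f(u) - f(xstar) >= alpha dist(u, X).  From
    above, let y in X be close to u.  The point y / <x, y> is the central
    projection of y onto the affine tangent space at x, so it is reachable in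
    the subproblem, and the first-order optimality condition
    ([prox_optimality]) compares f(z) with f(y / <x, y>).  Both x and y lie on
    the sphere, hence ||z|| and 1 / <x, y> differ only to second order, and d
    is of the order of ||x - u||; the outcome ([step_gap]) is
    f(u) - f(y) <= C eta ||u - y|| when all the points are within eta of each
    other.  Since f is constant on X, choosing y almost nearest to u makes the
    two bounds incompatible once C eta <= alpha / 2, unless f(u) <= f(xstar)
    ([weak_sharp_witness] picks y).

    An iterate x near xstar with f(x) <= f(xstar) is stationary: by homogeneity
    and ||z|| >= 1, f(z) >= f(u) >= f(xstar) >= f(x), so the subproblem cannot
    improve on d = 0 ([step_stationary]).  The sequence is therefore eventually
    constant, and its value is its limit. *)

(** * Euclidean geometry of column vectors *)

Section Euclid.
Variables (R : realType) (n : nat).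
Implicit Types (u v w x y : 'cV[R]_n) (a : R).

Lemma dotpC u v : dotp u v = dotp v u.
Proof. by apply: eq_bigr => i _; rewrite mulrC. Qed.

Lemma dotpDl u v w : dotp (u + v) w = dotp u w + dotp v w.
Proof. by rewrite -big_split; apply: eq_bigr => i _; rewrite mxE mulrDl. Qed.

Lemma dotpZl a u w : dotp (a *: u) w = a * dotp u w.
Proof. by rewrite mulr_sumr; apply: eq_bigr => i _; rewrite mxE mulrA. Qed.

Lemma dotpNl u w : dotp (- u) w = - dotp u w.
Proof. by rewrite -scaleN1r dotpZl mulN1r. Qed.

Lemma dotpDr u v w : dotp w (u + v) = dotp w u + dotp w v.
Proof. by rewrite dotpC dotpDl !(dotpC w). Qed.

Lemma dotpZr a u w : dotp w (a *: u) = a * dotp w u.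
Proof. by rewrite dotpC dotpZl dotpC. Qed.

Lemma dotpNr u w : dotp w (- u) = - dotp w u.
Proof. by rewrite dotpC dotpNl dotpC. Qed.

Definition dotpE := (dotpDl, dotpDr, dotpNl, dotpNr, dotpZl, dotpZr).

Lemma dotp_ge0 u : 0 <= dotp u u.
Proof. by apply: sumr_ge0 => i _; rewrite -expr2 sqr_ge0. Qed.

Lemma enorm_ge0 u : 0 <= enorm u.
Proof. exact: sqrtr_ge0. Qed.

Lemma sqr_enorm u : enorm u ^+ 2 = dotp u u.
Proof. by rewrite sqr_sqrtr // dotp_ge0. Qed.

Lemma enorm_eq0 u : enorm u = 0 -> u = 0.
Proof.
move=> u0; apply/matrixP => i j; rewrite (ord1 j) mxE.
have /eqP : dotp u u = 0 by rewrite -sqr_enorm u0 expr0n.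
rewrite psumr_eq0; last by move=> k _; rewrite -expr2 sqr_ge0.
by move=> /allP/(_ i (mem_index_enum i)) /=; rewrite -expr2 sqrf_eq0 => /eqP.
Qed.

Lemma enormN u : enorm (- u) = enorm u.
Proof. by rewrite /enorm !dotpE opprK. Qed.

Lemma enormB u v : enorm (u - v) = enorm (v - u).
Proof. by rewrite -enormN opprB. Qed.

Lemma cauchy_schwarz u v : dotp u v <= enorm u * enorm v.
Proof.
have [/eqP|u0] := eqVneq (enorm u) 0.
  by move=> /eqP/enorm_eq0 ->; rewrite -(scale0r 0) dotpZl mul0r
     mulr_ge0 // enorm_ge0.
have [/eqP|v0] := eqVneq (enorm v) 0.
  by move=> /eqP/enorm_eq0 ->; rewrite -(scale0r 0) dotpZr mul0r
     mulr_ge0 // enorm_ge0.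
have := dotp_ge0 (enorm v *: u - enorm u *: v).
rewrite !dotpE (dotpC v u) -!sqr_enorm => h.
have p : 0 < enorm u * enorm v.
  by rewrite mulr_gt0 // lt_def enorm_ge0 ?u0 ?v0.
rewrite -(ler_pM2l p); nra.
Qed.

Lemma enorm_triangle u v : enorm (u + v) <= enorm u + enorm v.
Proof.
rewrite -(@ler_pXn2r _ 2) // ?nnegrE ?addr_ge0 ?enorm_ge0 //.
rewrite sqr_enorm !dotpE (dotpC v u) sqrrD -!sqr_enorm.
have := cauchy_schwarz u v; lra.
Qed.

Lemma sqr_enormB_sphere u v : usphere u -> usphere v ->
  enorm (u - v) ^+ 2 = 2 - 2 * dotp u v.
Proof.
move=> u1 v1; rewrite sqr_enorm !dotpE (dotpC v u) -!sqr_enorm u1 v1; ring.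
Qed.

(** The topology on matrices is that of entrywise closeness; the factor
    [n.+1], rather than sqrt n, keeps the comparison free of the case n = 0. *)
Lemma cvg_enorm (x : nat -> 'cV[R]_n) (l : 'cV[R]_n) : x @ \oo --> l ->
  forall e : R, 0 < e ->
  exists k0, forall k, (k0 <= k)%N -> enorm (x k - l) <= e.
Proof.
move=> xl e e0.
have e'0 : 0 < e / n.+1%:R by rewrite divr_gt0.
have /cvg_ballP/(_ _ e'0) [k0 _ hk] := xl.
exists k0 => k kk; have [_ hb] := hk k kk.
rewrite -(@ler_pXn2r _ 2) ?nnegrE ?enorm_ge0 ?(ltW e0) // sqr_enorm.
apply: (@le_trans _ _ (\sum_(i < n) (e / n.+1%:R) ^+ 2)).
  apply: ler_sum => i _; rewrite -expr2 -real_normK ?num_real //.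
  rewrite ler_pXn2r ?nnegrE ?(ltW e'0) //.
  have := hb i 0; rewrite /ball /= !mxE distrC; exact: ltW.
rewrite sumr_const card_ord -[_ *+ n]mulr_natr expr_div_n -mulrA.
rewrite ler_piMr ?sqr_ge0 //.
rewrite mulrC ler_pdivrMr ?exprn_gt0 // mul1r -natrX ler_nat.
by rewrite (leq_trans (leqnSn n)) // -{1}(expn1 n.+1) leq_pexp2l.
Qed.

End Euclid.

(** * One step of the method *)

Section Step.
Variables (R : realType) (n : nat) (f : 'cV[R]_n -> R).
Hypothesis f_cvx : forall (s : R) (u v : 'cV[R]_n), 0 <= s -> s <= 1 ->
  f ((1 - s) *: u + s *: v) <= (1 - s) * f u + s * f v.
Hypothesis f_homog : forall (s : R) (u : 'cV[R]_n), 0 <= s ->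
  f (s *: u) = s * f u.
Hypothesis f_ge0 : forall u, 0 <= f u.
Variables (t : R) (x d : 'cV[R]_n).
Hypothesis t_gt0 : 0 < t.
Hypothesis x_sphere : usphere x.
Hypothesis d_min :
  is_minimizer (fun e => f (x + e) + (2 * t)^-1 * enorm e ^+ 2)
    [set e | dotp x e = 0] d.

Let z : 'cV[R]_n := x + d.
Let u : 'cV[R]_n := (enorm z)^-1 *: z.

(** First-order optimality without subgradients: moving from [d] towards the
    feasible [w] by a fraction [s] cannot decrease the objective; convexity
    bounds the change of [f] linearly in [s], and [s] tends to 0. *)
Lemma prox_optimality (w : 'cV[R]_n) : dotp x w = 0 ->
  f z - f (x + w) <= t^-1 * dotp d (w - d).
Proof.
move=> xw; have [xd dmin] := d_min.
set c := (2 * t)^-1 in dmin *.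
have tc : t^-1 = 2 * c by rewrite /c; field; rewrite gt_eqF.
have c0 : 0 < c by rewrite invr_gt0 mulr_gt0.
set E := dotp (w - d) (w - d).
have E0 : 0 <= E by exact: dotp_ge0.
have small (s : R) : 0 < s -> s <= 1 ->
    f z - f (x + w) <= t^-1 * dotp d (w - d) + s * (c * E).
  move=> s0 s1.
  have feas : [set e | dotp x e = 0] (d + s *: (w - d)).
    by rewrite /= !dotpE xw xd; ring.
  have := dmin _ feas.
  have -> : x + (d + s *: (w - d)) = (1 - s) *: z + s *: (x + w).
    by apply/matrixP => i j; rewrite !mxE; ring.
  have := f_cvx z (x + w) (ltW s0) s1.
  rewrite !sqr_enorm -/z => h1 h2.
  rewrite -(ler_pM2l s0) tc.
  have -> : s * (2 * c * dotp d (w - d) + s * (c * E)) =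
    c * dotp (d + s *: (w - d)) (d + s *: (w - d)) - c * dotp d d.
    by rewrite /E !dotpE (dotpC w d); ring.
  lra.
apply/ler_addgt0Pr => e e0.
have p : 0 < c * E + 1 by rewrite ltr_wpDl // mulr_ge0 // ltW.
set s := Order.min 1 (e / (c * E + 1)).
have s0 : 0 < s by rewrite lt_min ltr01 divr_gt0.
have s1 : s <= 1 by rewrite ge_min lexx.
have : s * (c * E + 1) <= e by rewrite -ler_pdivlMr // ge_min lexx orbT.
have := small s s0 s1; lra.
Qed.

Lemma enorm_step_sqr : enorm z ^+ 2 = 1 + enorm d ^+ 2.
Proof.
have [xd _] := d_min.
by rewrite sqr_enorm !dotpE (dotpC d x) xd -!sqr_enorm x_sphere; ring.
Qed.

Lemma enorm_step_ge1 : 1 <= enorm z.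
Proof.
rewrite -(@ler_pXn2r _ 2) // ?nnegrE ?enorm_ge0 // enorm_step_sqr.
by rewrite expr1n lerDl sqr_ge0.
Qed.

Lemma step_sphere : usphere u.
Proof.
have z1 := enorm_step_ge1.
rewrite /usphere /= /enorm dotpZl dotpZr -sqr_enorm expr2.
rewrite mulKf ?mulVf ?sqrtr1 //.
  by rewrite gt_eqF // (lt_le_trans ltr01).
by rewrite gt_eqF // (lt_le_trans ltr01).
Qed.

Lemma step_unnormalize : z = enorm z *: u.
Proof.
by rewrite /u scalerA mulfV ?scale1r // gt_eqF // (lt_le_trans ltr01)
  ?enorm_step_ge1.
Qed.

(** If [x] is no worse than its successor, the subproblem has nothing to gain:
    normalization divides [f] by ||z|| >= 1, so [z] is no better than [u], and
    any [d] other than 0 pays the quadratic penalty. *)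
Lemma step_stationary : f x <= f u -> u = x.
Proof.
move=> xu; have [_ dmin] := d_min.
have z1 := enorm_step_ge1.
have fz : f z = enorm z * f u.
  by rewrite {1}step_unnormalize f_homog // enorm_ge0.
have feas0 : [set e | dotp x e = 0] 0.
  by rewrite /= -(scale0r 0) dotpZr mul0r.
have := dmin _ feas0; rewrite addr0 -/z fz.
have -> : enorm (0 : 'cV[R]_n) = 0.
  by rewrite -(scale0r 0) /enorm dotpZl mul0r sqrtr0.
rewrite expr0n /= mulr0 addr0 => h.
have c0 : 0 < (2 * t)^-1 by rewrite invr_gt0 mulr_gt0.
have : (2 * t)^-1 * enorm d ^+ 2 <= 0.
  by have := f_ge0 u; nra.
rewrite pmulr_rle0 // => d2.
have d0 : d = 0.
  by apply: enorm_eq0; apply/eqP; rewrite -sqrf_eq0 eq_le d2 sqr_ge0.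
by rewrite /u /z d0 addr0 x_sphere invr1 scale1r.
Qed.

(** The upper bound on f(u) - f(y).  The competitor [r^-1 *: y], with
    r = <x, y>, is where the ray through [y] meets the affine tangent space at
    [x]; likewise z = s^-1 u with s = <x, u>.  Both r and s are close to 1, and
    s - r = <x - u, u - y> + ||u - y||^2 / 2 is of second order. *)
Lemma step_gap (y : 'cV[R]_n) (eta : R) : usphere y -> eta <= 2^-1 ->
  enorm (x - u) <= eta -> enorm (u - y) <= eta -> f y <= f u ->
  f u - f y <= (6 * f y + 12 / t) * eta * enorm (u - y).
Proof.
move=> y1 eta2 hb ha fyu.
have [xd _] := d_min.
have x1 := x_sphere.
have u1 := step_sphere.
have N1 := enorm_step_ge1.
have zu := step_unnormalize.
have dN := enorm_step_sqr.
have opt := prox_optimality.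
have zE : z = x + d by [].
clearbody u; clearbody z.
set a := enorm (u - y) in ha *; set b := enorm (x - u) in hb.
have a0 : 0 <= a by exact: enorm_ge0.
have b0 : 0 <= b by exact: enorm_ge0.
set N := enorm z in N1 zu dN.
set r := dotp x y; set s := dotp x u; set q := dotp u y.
have Ns : N * s = 1.
  rewrite /s -dotpZr -zu zE dotpDr xd -sqr_enorm x1.
  by rewrite expr1n addr0.
have bs : b ^+ 2 = 2 - 2 * s by exact: sqr_enormB_sphere.
have aq : a ^+ 2 = 2 - 2 * q by exact: sqr_enormB_sphere.
have rxy : enorm (x - y) ^+ 2 = 2 - 2 * r by exact: sqr_enormB_sphere.
have xy : enorm (x - y) <= b + a.
  by have := enorm_triangle (x - u) (u - y); rewrite addrA subrK.
have xy0 : 0 <= enorm (x - y) by exact: enorm_ge0.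
have r2 : 2^-1 <= r by nra.
have s2 : 2^-1 <= s by nra.
have s1 : s <= 1 by nra.
have r0 : 0 < r by lra.
have srle : s - r <= b * a + a ^+ 2 / 2.
  have := cauchy_schwarz (x - u) (u - y).
  rewrite !dotpE -/a -/b -/r -/s -/q -sqr_enorm u1; lra.
have srle1 : s - r <= a.
  by have := cauchy_schwarz x (u - y);
     rewrite !dotpE -/a x1 -/r -/s; lra.
have srge1 : - a <= s - r.
  by have := cauchy_schwarz x (y - u);
     rewrite !dotpE enormB -/a x1 -/r -/s; lra.
set ri := r^-1.
have rir : ri * r = 1 by rewrite mulVf // gt_eqF.
have ri0 : 0 < ri by rewrite invr_gt0.
have ri2 : ri <= 2 by nra.
have N2 : N <= 2 by nra.
(* [g] is the difference of the lengths of the competitor and of [z]; it is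
   what survives of f(y) when the two values of [f] are compared. *)
set g := ri - N.
have gE : g = ri * N * (s - r).
  rewrite /g -[X in X - _ = _]mulr1 -Ns -[X in _ - X = _]mulr1 -{1}rir; ring.
have P4 : ri * N <= 4 by nra.
have P0 : 0 < ri * N by nra.
have gle : g <= 4 * (b * a + a ^+ 2 / 2).
  rewrite gE; have : 0 <= b * a + a ^+ 2 / 2 by nra.
  by nra.
have g2 : g ^+ 2 <= 16 * a ^+ 2.
  have h1 : (s - r) ^+ 2 <= a ^+ 2 by nra.
  have h2 : (ri * N) ^+ 2 <= 16 by nra.
  rewrite gE exprMn; apply: ler_pM => //; exact: sqr_ge0.
set w := ri *: y - x.
have xw : dotp x w = 0.
  by rewrite /w !dotpE -/r rir -sqr_enorm x1; ring.
have := opt _ xw.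
have -> : x + w = ri *: y by rewrite /w addrC subrK.
have -> : w - d = ri *: y - z by rewrite /w zE opprD addrA.
set e := ri *: y - z.
have e6 : enorm e <= 6 * a.
  rewrite -(@ler_pXn2r _ 2) ?nnegrE ?enorm_ge0 ?mulr_ge0 //.
  have -> : enorm e ^+ 2 = g ^+ 2 + ri * N * a ^+ 2.
    rewrite sqr_enorm /e zu !dotpE -!(dotpC u) -/q.
    rewrite -!sqr_enorm y1 u1 aq /g; ring.
  have : ri * N * a ^+ 2 <= 4 * a ^+ 2 by rewrite ler_wpM2r // sqr_ge0.
  by have := sqr_ge0 a; lra.
have d2 : enorm d <= 2 * b.
  rewrite -(@ler_pXn2r _ 2) ?nnegrE ?enorm_ge0 ?mulr_ge0 //.
  (* ||d||^2 = N^2 (1 - s^2) is the squared tangent of the angle between [x]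
     and [u], hence comparable to their squared distance 2 (1 - s). *)
  have -> : enorm d ^+ 2 = N ^+ 2 - (N * s) ^+ 2 by rewrite Ns dN; ring.
  have -> : N ^+ 2 - (N * s) ^+ 2 = N ^+ 2 * ((1 - s) * (1 + s)) by ring.
  have -> : (2 * b) ^+ 2 = 4 * (2 * (1 - s)) by rewrite exprMn bs; ring.
  apply: ler_pM; nra.
have de : dotp d e <= 12 * eta * a.
  have h1 := cauchy_schwarz d e.
  have h2 : enorm d * enorm e <= (2 * b) * (6 * a).
    by apply: ler_pM; rewrite ?enorm_ge0.
  have : b * a <= eta * a by rewrite ler_wpM2r.
  lra.
rewrite (@f_homog ri) ?(ltW ri0) // {1}zu f_homog; last lra.
have ti0 : 0 < t^-1 by rewrite invr_gt0.
have tde : t^-1 * dotp d e <= 12 / t * eta * a.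
  have := ler_wpM2l (ltW ti0) de; lra.
have gf : g * f y <= 6 * eta * a * f y.
  apply: ler_wpM2r => //; apply: (le_trans gle).
  have : b * a <= eta * a by rewrite ler_wpM2r.
  have : a * a <= eta * a by rewrite ler_wpM2r.
  rewrite expr2; lra.
have Nf : f u - f y <= N * (f u - f y) by rewrite ler_peMl // subr_ge0.
rewrite /g in gf; lra.
Qed.

End Step.

(** * Weak sharpness in real terms *)

Section Sharp.
Variables (R : realType) (n p : nat) (Y : 'M[R]_(n, p)).
Variables (X : set 'cV[R]_n) (alpha delta : R).
Hypothesis hX : X `<=` usphere.
Hypothesis hsharp : weak_sharp_minima (Fhat Y) X alpha delta.

Let f (u : 'cV[R]_n) : R := l1norm (Y^T *m u).

Lemma Fhat_sphere u : usphere u -> Fhat Y u = (f u)%:E.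
Proof. by move=> u1; rewrite /Fhat /delta_ind mem_set // adde0. Qed.

Lemma dist_ge0 (u : 'cV[R]_n) : (0 <= dist u X)%E.
Proof.
by apply: le_ereal_inf_tmp => _ [y _ <-]; rewrite lee_fin enorm_ge0.
Qed.

Lemma dist_le (u y : 'cV[R]_n) : X y -> (dist u X <= (enorm (u - y))%:E)%E.
Proof. by move=> Xy; apply: ereal_inf_lbound; exists y. Qed.

Lemma sharp_le y u : X y -> usphere u ->
  (exists2 y0, X y0 & enorm (u - y0) <= delta) -> f y <= f u.
Proof.
move=> Xy u1 [y0 Xy0 uy0]; have [_ _ alpha0 _ sh] := hsharp.
have := sh y u Xy (le_trans (dist_le u Xy0) _).
rewrite lee_fin uy0 => /(_ isT).
rewrite !Fhat_sphere //; last exact: hX.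
move=> h; rewrite -lee_fin; apply: le_trans h.
by rewrite leeDl // mule_ge0 ?dist_ge0 // lee_fin ltW.
Qed.

Lemma sharp_const y y' : X y -> X y' -> f y = f y'.
Proof.
have [_ _ _ delta0 _] := hsharp.
have self v : X v -> exists2 y0, X y0 & enorm (v - y0) <= delta.
  move=> Xv; exists v => //.
  by rewrite subrr -(scale0r 0) /enorm dotpZl mul0r sqrtr0 ltW.
move=> Xy Xy'; apply/eqP; rewrite eq_le.
by apply/andP; split; apply: sharp_le => //; by [exact: hX|exact: self].
Qed.

(** As [X] need not be closed there may be no nearest point to [u].  Giving up
    a factor 2 in the sharpness constant leaves room for an actual point of
    [X], which can moreover be taken no farther from [u] than [y0]. *)
Lemma weak_sharp_witness u y0 : usphere u -> X y0 -> enorm (u - y0) <= delta ->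
  f y0 < f u ->
  exists y, [/\ X y, enorm (u - y) <= enorm (u - y0) &
                alpha * enorm (u - y) < 2 * (f u - f y0)].
Proof.
move=> u1 Xy0 uy0 lt_f; have [_ _ alpha0 _ sh] := hsharp.
have := sh y0 u Xy0 (le_trans (dist_le u Xy0) _).
rewrite lee_fin uy0 => /(_ isT).
rewrite !Fhat_sphere //; last exact: hX.
have [/ereal_inf_lt [_ [y Xy <-]]|far] :=
  ltP (dist u X) (2 * (f u - f y0) / alpha)%:E.
  rewrite lte_fin ltr_pdivlMr // mulrC => hy _.
  have [le|/ltW le] := lerP (enorm (u - y)) (enorm (u - y0)); first by exists y.
  exists y0; split => //; apply: le_lt_trans hy.
  by rewrite ler_pM2l.
have := dist_le u Xy0; have := dist_ge0 u.
case: (dist u X) far => [D| |] //.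
rewrite !lee_fin ler_pdivrMr // => h _ _ h2.
lra.
Qed.

End Sharp.

(** * The objective, and finite convergence *)

Section L1.
Variables (R : realType) (n p : nat) (Y : 'M[R]_(n, p)).

Lemma l1norm_ge0 (v : 'cV[R]_n) : 0 <= l1norm v.
Proof. exact: sumr_ge0. Qed.

Lemma l1norm_mul_homog (s : R) (u : 'cV[R]_n) : 0 <= s ->
  l1norm (Y^T *m (s *: u)) = s * l1norm (Y^T *m u).
Proof.
move=> s0; rewrite -scalemxAr /l1norm mulr_sumr; apply: eq_bigr => i _.
by rewrite mxE normrM ger0_norm.
Qed.

Lemma l1norm_mul_convex (s : R) (u v : 'cV[R]_n) : 0 <= s -> s <= 1 ->
  l1norm (Y^T *m ((1 - s) *: u + s *: v)) <=
  (1 - s) * l1norm (Y^T *m u) + s * l1norm (Y^T *m v).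
Proof.
move=> s0 s1; rewrite -!l1norm_mul_homog ?subr_ge0 // mulmxDr.
rewrite /l1norm -big_split; apply: ler_sum => i _.
by rewrite [X in `|X|]mxE ler_normD.
Qed.

End L1.

Theorem theorem4p8 (R : realType) (n p : nat) (Y : 'M[R]_(n, p))
    (X : set 'cV[R]_n) (alpha delta t : R)
    (x d : nat -> 'cV[R]_n) (xstar : 'cV[R]_n)
    (hX : X `<=` usphere)
    (hsharp : weak_sharp_minima (Fhat Y) X alpha delta)
    (hgen : ManPPA_rw Y t x d)
    (hlim : x @ \oo --> xstar)
    (hstar : X xstar) :
  exists k0 : nat, forall k : nat, (k0 <= k)%N -> x k = xstar.
Proof.
have [_ _ alpha0 delta0 _] := hsharp.
have [x0 t0 _ dmin xS] := hgen.
pose f (u : 'cV[R]_n) : R := l1norm (Y^T *m u).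
have f_ge0 (u : 'cV[R]_n) : 0 <= f u by exact: l1norm_ge0.
have f_homog (s : R) (u : 'cV[R]_n) : 0 <= s -> f (s *: u) = s * f u.
  exact: l1norm_mul_homog.
have f_cvx (s : R) (u v : 'cV[R]_n) : 0 <= s -> s <= 1 ->
    f ((1 - s) *: u + s *: v) <= (1 - s) * f u + s * f v.
  exact: l1norm_mul_convex.
have x1 k : usphere (x k).
  by elim: k => [//|k IH]; rewrite xS;
    exact: (step_sphere (f := f) IH (dmin k)).
(* The constant of [step_gap]; [eta] makes [C * eta] too small for the strict
   inequality of [weak_sharp_witness], while staying inside the sharpness
   neighbourhood. *)
pose C := 6 * f xstar + 12 / t.
have C0 : 0 < C.
  by rewrite ltr_wpDl ?mulr_ge0 // divr_gt0.
pose eta := Order.min 2^-1 (Order.min delta (alpha / 2 / C)).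
have eta0 : 0 < eta by rewrite !lt_min delta0 invr_gt0 ltr0n !divr_gt0.
have eta2 : eta <= 2^-1 by rewrite ge_min lexx.
have etad : eta <= delta by rewrite !ge_min lexx !orbT.
have etaC : C * eta <= alpha / 2.
  by rewrite mulrC -ler_pdivlMr // !ge_min lexx !orbT.
have eta20 : 0 < eta / 2 by rewrite divr_gt0.
(* Halving leaves room for two consecutive iterates within [eta] of each other,
   and for a witness within [eta] of the iterate. *)
have [k0 near] := cvg_enorm hlim eta20.
have low k : (k0 <= k)%N -> f (x k.+1) <= f xstar.
  move=> kk; have kk1 : (k0 <= k.+1)%N by exact: leqW.
  rewrite leNgt; apply/negP => lt_f.
  have n0 := near k kk; have n1 := near k.+1 kk1.
  have [|y [Xy uy]] := weak_sharp_witness hX hsharp (x1 k.+1) hstar _ lt_f;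
    first lra.
  rewrite -/(f _) -/(f _) => hy.
  have fy : f y = f xstar by exact: (sharp_const hX hsharp).
  have b : enorm (x k - x k.+1) <= eta.
    have := enorm_triangle (x k - xstar) (xstar - x k.+1).
    rewrite addrA subrK (enormB xstar); lra.
  have a : enorm (x k.+1 - y) <= eta by lra.
  have := step_gap f_cvx f_homog f_ge0 t0 (x1 k) (dmin k) (hX _ Xy) eta2.
  rewrite -xS fy -/C => /(_ b a (ltW lt_f)) gap.
  have := ler_wpM2r (enorm_ge0 (x k.+1 - y)) etaC.
  lra.
have stay k : (k0 < k)%N -> x k.+1 = x k.
  case: k => // k kk; rewrite [LHS]xS.
  apply: (step_stationary f_homog f_ge0 t0 (x1 _) (dmin _)); rewrite -xS.
  apply: (le_trans (low k kk)).
  apply: (sharp_le hX hsharp) => //.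
  by exists xstar => //; have := near k.+2 (leqW (leqW kk)); lra.
have const k : x (k0.+1 + k)%N = x k0.+1.
  by elim: k => [|k IH]; rewrite ?addn0 // addnS stay // leq_addr.
have xk : x k0.+1 = xstar.
  apply/eqP; rewrite -subr_eq0; apply/eqP/enorm_eq0/eqP.
  rewrite eq_le enorm_ge0 andbT; apply/ler_addgt0Pr => e e0; rewrite add0r.
  have [k1 h] := cvg_enorm hlim e0.
  by have := h (k0.+1 + k1)%N (leq_addl _ _); rewrite const.
by exists k0.+1 => k kk; rewrite -(subnKC kk) const.
Qed.
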